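(* Let $\vec G=(G,\alpha,w)$ be a finite magnetic graph with underlying graph $G=(V,E,\partial)$, let $V_1\subseteq V_0\subseteq V$, and let $A$ be an $s$-partition of $r\in\mathbb{N}$. Then the spectrum of the normalised magnetic Laplacian of the $V_1$-contracted $A$-union $\vec F_{A,V_1}=\vec F_{A,V_1}(\vec G,V_0)$ is $$\operatorname{spec}(\vec F_{A,V_1})=\operatorname{spec}(\vec G)\uplus\operatorname{spec}(\vec G^+_{V_0})^{(r-s)}\uplus\operatorname{spec}(\vec G^+_{V_1})^{(s-1)}.$$
   Context: A graph $G=(V,E,\partial)$: finite disjoint sets $V,E$, incidence $\partial e=(\partial_-e,\partial_+e)$, inversion $e\mapsto\bar e$ ($\bar{\bar e}=e$, $\bar e\ne e$, $\partial_\pm\bar e=\partial_\mp e$); loops/multiple edges allowed; $E_v=\{e:\partial_-e=v\}$, $\deg v=|E_v|>0$. A magnetic graph $\vec G=(G,\alpha,w)$ has $w:E\to(0,\infty)$, $w_{\bar e}=w_e$, and $\alpha:E\to\mathbb{R}/2\pi\mathbb{Z}$, $\alpha_{\bar e}=-\alpha_e$; $\deg^wv=\sum_{e\in E_v}w_e$. The (normalised) magnetic Laplacian on $\ell^2(V,\deg^w)$ is $(\Delta f)(v)=f(v)-\frac1{\deg^wv}\sum_{e\in E_v}w_ee^{i\alpha_e}f(\partial_+e)$; $\operatorname{spec}(\vec G)$ is its eigenvalue multiset. For $W\subseteq V$, $\operatorname{spec}(\vec G^+_W)$ is the eigenvalue multiset of the Dirichlet Laplacian $\iota_W^*\Delta\iota_W$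 with $\iota_W:\ell^2(V\setminus W,\deg^w)\to\ell^2(V,\deg^w)$ extension by zero. Contraction of vertices along an equivalence relation keeps all edges (with their weights and potentials) and replaces vertices by classes, incidence $e\mapsto([\partial_-e],[\partial_+e])$. Frame member: $G^a$ is the disjoint union of $a$ copies $G\times\{j\}$; with $(v,i)\sim(v',j)$ iff $(v,i)=(v',j)$ or ($v=v'\in V_0$), $F_a(\vec G,V_0)=G^a/\!\sim$ with $w_{(e,j)}=w_e$, $\alpha_{(e,j)}=\alpha_e$. An $s$-partition of $r$ is a multiset $A=\{\!\{a_1,\dots,a_s\}\!\}$ of natural numbers with sum $r$. $\vec F_A=\bigsqcup_{i=1}^sF_{a_i}(\vec G,V_0)\times\{i\}$, and $\vec F_{A,V_1}$ is obtained from $\vec F_A$ by contracting, for each $v_1\in V_1$, the $s$ vertices $([v_1],i)$, $i=1,\dots,s$, into one vertex. Multisets: $\uplus$ adds multiplicities; $M^{(k)}$ multiplies multiplicities by $k$ ($M^{(0)}$ empty). *)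

(* Defs.v *)
From HB Require Import structures.
From mathcomp Require Import all_boot all_order all_algebra.
From mathcomp Require Import reals trigo.
From mathcomp Require Import complex.

Set Implicit Arguments.
Unset Strict Implicit.
Unset Printing Implicit Defensive.

Import Order.TTheory GRing.Theory Num.Theory.
Local Open Scope ring_scope.
Local Open Scope complex_scope.

(* A (finite) magnetic graph: finite vertex and edge sets, incidence
   src e = \partial_- e, tgt e = \partial_+ e, inversion einv e = \bar e,
   weights wt and magnetic potential pot (a real representative of
   alpha_e in R / 2 pi Z). *)
Record mgraph (R : realType) := MGraph {
  vert : finType;
  edge : finType;
  src : edge -> vert;
  tgt : edge -> vert;
  einv : edge -> edge;
  wt : edge -> R;
  pot : edge -> R
}.
Arguments MGraph {R}.
Arguments vert {R}.
Arguments edge {R}.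
Arguments src {R} m _.
Arguments tgt {R} m _.
Arguments einv {R} m _.
Arguments wt {R} m _.
Arguments pot {R} m _.



Section MagneticGraphs.

Variable R : realType.
Local Notation mgraph := (mgraph R).

Notation C := (complex R).

Definition is_mgraph (G : mgraph) : Prop :=
  (forall e, einv G (einv G e) = e) /\
  (forall e, einv G e <> e) /\
  (forall e, src G (einv G e) = tgt G e /\ tgt G (einv G e) = src G e) /\
  (forall e, 0 < wt G e /\ wt G (einv G e) = wt G e) /\
  (forall e, exists k : int, pot G (einv G e) = - pot G e + k%:~R * (2 * pi)) /\
  (forall v, exists e, src G e = v).

Definition expi (a : R) : C := Complex (cos a) (sin a).

Definition degw (G : mgraph) (v : vert G) : R := \sum_(e | src G e == v) wt G e.

Definition lapop (G : mgraph) (f : vert G -> C) (u : vert G) : C :=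
  f u - ((degw u)^-1)%:C *
        \sum_(e | src G e == u) (wt G e)%:C * expi (pot G e) * f (tgt G e).

Definition lapmx (G : mgraph) : 'M[C]_#|vert G| :=
  \matrix_(i, j) lapop (fun x => (x == enum_val j)%:R) (enum_val i).

(* matrix of the Dirichlet Laplacian iota_W^* Delta iota_W on
   l^2(V \ W, deg^w): iota_W extends by zero, and its adjoint w.r.t. the
   deg^w-weighted inner products is the restriction to V \ W. *)
Definition dirmx (G : mgraph) (W : {set vert G}) : 'M[C]_#|~: W| :=
  \matrix_(i, j) lapop (fun x => (x == enum_val j)%:R) (enum_val i).

Lemma spec_ex n (M : 'M[C]_n) :
  exists s : seq C, char_poly M == \prod_(z <- s) ('X - z%:P).
Proof.
have [s Hs] := closed_field_poly_normal (char_poly M).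
by exists s; apply/eqP; rewrite {1}Hs (monicP (char_poly_monic M)) scale1r.
Qed.

Definition spec n (M : 'M[C]_n) : seq C := xchoose (spec_ex M).

(* multiset operations: union is ++ (up to perm_eq), M^(k) is mscale k M *)
Definition mscale (k : nat) (s : seq C) : seq C := flatten (nseq k s).

(* contraction along a relation r (an equivalence relation): vertices are
   the classes [x] = [set y | r x y]; edges, weights, potentials kept *)
Definition cls_set (G : mgraph) (r : rel (vert G)) (x : vert G) : {set vert G} :=
  [set y | r x y].

Definition classes (G : mgraph) (r : rel (vert G)) : {set {set vert G}} :=
  [set cls_set r x | x : vert G].

Definition cvert (G : mgraph) (r : rel (vert G)) : finType :=
  {X : {set vert G} | X \in classes r}.

Lemma cls_in (G : mgraph) (r : rel (vert G)) x : cls_set r x \in classes r.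
Proof. by apply/imsetP; exists x. Qed.

Definition ccls (G : mgraph) (r : rel (vert G)) (x : vert G) : cvert r :=
  exist _ (cls_set r x) (cls_in r x).

Definition contract (G : mgraph) (r : rel (vert G)) : mgraph :=
  @MGraph R (cvert r) (edge G) (fun e => ccls r (src G e)) (fun e => ccls r (tgt G e))
    (einv G) (wt G) (pot G).

Definition gpow (G : mgraph) (a : nat) : mgraph :=
  @MGraph R (vert G * 'I_a)%type (edge G * 'I_a)%type
    (fun e => (src G e.1, e.2)) (fun e => (tgt G e.1, e.2))
    (fun e => (einv G e.1, e.2)) (fun e => wt G e.1) (fun e => pot G e.1).

Definition frame_rel (G : mgraph) (V0 : {set vert G}) (a : nat) :
  rel (vert (gpow G a)) :=
  fun (x y : vert G * 'I_a) => (x == y) || ((x.1 == y.1) && (x.1 \in V0)).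

Definition frame (G : mgraph) (V0 : {set vert G}) (a : nat) : mgraph :=
  contract (@frame_rel G V0 a).

Definition fcls (G : mgraph) (V0 : {set vert G}) (a : nat)
  (x : vert G * 'I_a) : vert (frame V0 a) :=
  ccls (@frame_rel G V0 a) x.

Definition gunion (s : nat) (Gs : 'I_s -> mgraph) : mgraph :=
  @MGraph R {i : 'I_s & vert (Gs i)} {i : 'I_s & edge (Gs i)}
    (fun e => Tagged (fun i => vert (Gs i)) (src (Gs (tag e)) (tagged e)))
    (fun e => Tagged (fun i => vert (Gs i)) (tgt (Gs (tag e)) (tagged e)))
    (fun e => Tagged (fun i => edge (Gs i)) (einv (Gs (tag e)) (tagged e)))
    (fun e => wt (Gs (tag e)) (tagged e))
    (fun e => pot (Gs (tag e)) (tagged e)).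

Definition frame_union (G : mgraph) (V0 : {set vert G}) (A : seq nat) : mgraph :=
  @gunion (size A) (fun i => frame V0 (nth 0%N A i)).

Definition union_rel (G : mgraph) (V0 V1 : {set vert G}) (A : seq nat) :
  rel (vert (frame_union V0 A)) :=
  fun x y => (x == y) ||
    [exists v1 in V1,
       [exists j, tagged x == fcls V0 (v1, j)] &&
       [exists j, tagged y == fcls V0 (v1, j)]].

Definition frame_union_contr (G : mgraph) (V0 V1 : {set vert G}) (A : seq nat) :
  mgraph := contract (@union_rel G V0 V1 A).

End MagneticGraphs.

(* Main.v *)
(* A function f on the contracted union is a family f_k of functions on V, one
   for each copy k of G, that agree on the glued vertices, and the Laplacian of
   f at a vertex is the mean of the Laplacians of the f_k over the copies glued
   there.  Fix a base copy c i in each frame i and a base frame i0.  Replace f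
   by
     - f_(c i0), on V,
     - f_(c i) - f_(c i0) for i <> i0, which vanishes on V1,
     - f_k - f_(c i) for k <> c i in frame i, which vanishes on V0.
   In these coordinates the Laplacian is block triangular: subtracting cancels
   the mean wherever a difference is not forced to vanish.  Its diagonal blocks
   are the Laplacian of G once, the Dirichlet Laplacian of V1 s - 1 times and
   that of V0 r - s times, so the characteristic polynomial factors. *)
Require Import Defs.
From HB Require Import structures.
From mathcomp Require Import all_boot all_order all_algebra.
From mathcomp Require Import reals trigo complex.
From mathcomp Require Import boolp.
From mathcomp Require Import ring.

Set Implicit Arguments.
Unset Strict Implicit.
Unset Printing Implicit Defensive.

Import GRing.Theory Num.Theory.
Local Open Scope ring_scope.

(** * Linear operators on functions over finite types and their characteristic polynomials *)

Section LinearOperators.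
Variable K : comNzRingType.
Implicit Types T S U : finType.

Definition delta T (v : T) : T -> K := fun x => (x == v)%:R.

Definition linear_op T S (F : (T -> K) -> (S -> K)) : Prop :=
  forall a f g u, F (fun x => a * f x + g x) u = a * F f u + F g u.

Lemma linear_op0 T S (F : (T -> K) -> (S -> K)) u :
  linear_op F -> F (fun=> 0) u = 0.
Proof.
move=> /(_ (-1) (fun=> 0) (fun=> 0) u).
rewrite (_ : (fun x : T => _) = fun=> 0); last by apply/funext=> x; ring.
by move=> ->; ring.
Qed.

Lemma linear_opE T S (F : (T -> K) -> (S -> K)) f u :
  linear_op F -> F f u = \sum_v F (delta v) u * f v.
Proof.
move=> linF.
have -> : f = fun x => \sum_v f v * delta v x.
  apply/funext=> x; rewrite (bigD1 x) //= /delta eqxx mulr1 big1 ?addr0 //.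
  by move=> v /negbTE nvx; rewrite eq_sym nvx mulr0.
transitivity (\sum_v f v * F (delta v) u).
  elim: (index_enum T) => [|v s IHs].
    rewrite big_nil; apply: etrans (linear_op0 u linF); congr (F _ u).
    by apply/funext=> x; rewrite big_nil.
  rewrite big_cons -IHs -linF; congr (F _ u); apply/funext=> x.
  by rewrite big_cons.
apply: eq_bigr => v _; rewrite mulrC; congr (_ * _).
rewrite (bigD1 v) //= /delta eqxx mulr1 big1 ?addr0 //.
by move=> w /negbTE nvw; rewrite eq_sym nvw mulr0.
Qed.

Lemma linear_op_comp T S U (F : (S -> K) -> (U -> K)) (G : (T -> K) -> (S -> K)) :
  linear_op F -> linear_op G -> linear_op (fun f => F (G f)).
Proof.
move=> linF linG a f g u; rewrite -linF; congr (F _ u).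
by apply/funext=> x; rewrite linG.
Qed.

(** The enumerations are arguments because block matrices need a sum type listed summand by
    summand. *)
Definition op_mx T S n m (e : 'I_n -> T) (e' : 'I_m -> S)
    (F : (T -> K) -> (S -> K)) : 'M[K]_(m, n) :=
  \matrix_(i, j) F (delta (e j)) (e' i).

Lemma op_mx_comp T S U n m p (e : 'I_n -> T) (e' : 'I_m -> S) (e'' : 'I_p -> U)
    (F : (S -> K) -> (U -> K)) (G : (T -> K) -> (S -> K)) :
  linear_op F -> bijective e' ->
  op_mx e e'' (fun f => F (G f)) = op_mx e' e'' F *m op_mx e e' G.
Proof.
move=> linF be'; apply/matrixP=> i j; rewrite !mxE linear_opE //.
rewrite (reindex e') /=; last exact: onW_bij.
by apply: eq_bigr => k _; rewrite !mxE.
Qed.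

Lemma op_mx_id T n (e : 'I_n -> T) : injective e -> op_mx e e id = 1%:M.
Proof. by move=> ie; apply/matrixP=> i j; rewrite !mxE /delta (inj_eq ie). Qed.

(** [X - N] equals [A (X - M) B], and the determinants of [A] and [B] cancel. The two inverse
    identities also force [n = m], which makes the sizes match. *)
Lemma char_poly_sim n m (M : 'M[K]_n) (N : 'M[K]_m) (A : 'M[K]_(m, n)) B :
  A *m B = 1%:M -> B *m A = 1%:M -> A *m M = N *m A ->
  char_poly M = char_poly N.
Proof.
move=> AB BA AM.
have nm : n = m by apply/eqP; rewrite eqn_leq !(mulmx1_min AB, mulmx1_min BA).
case: _ / nm => /= in N A B AB BA AM *.
have eN : N = A *m M *m B by rewrite AM -mulmxA AB mulmx1.
rewrite /char_poly.
have -> : char_poly_mx N =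
    map_mx polyC A *m char_poly_mx M *m map_mx polyC B.
  rewrite /char_poly_mx mulmxBr mulmxBl -!map_mxM -eN; congr (_ - _).
  by rewrite scalar_mxC -mulmxA -map_mxM AB map_mx1 mulmx1.
rewrite !det_mulmx mulrAC -det_mulmx -map_mxM AB map_mx1 det1 mul1r //.
Qed.

Definition op_char_poly T (F : (T -> K) -> (T -> K)) : {poly K} :=
  char_poly (op_mx (@enum_val T predT) enum_val F).

(** The matrices of [P] and [Q] are mutually inverse, and that of [P] intertwines those of [F] and
    [G]. *)
Lemma op_mx_sim T S n m (e : 'I_n -> T) (e' : 'I_m -> S) F G
    (P : (T -> K) -> (S -> K)) (Q : (S -> K) -> (T -> K)) :
  bijective e -> bijective e' ->
  linear_op F -> linear_op G -> linear_op P -> linear_op Q ->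
  (forall f u, P (Q f) u = f u) -> (forall f u, Q (P f) u = f u) ->
  (forall f u, P (F f) u = G (P f) u) ->
  char_poly (op_mx e e F) = char_poly (op_mx e' e' G).
Proof.
move=> be be' linF linG linP linQ PQ QP PF.
apply: (@char_poly_sim _ _ _ _ (op_mx e e' P) (op_mx e' e Q)).
- rewrite -op_mx_comp // -(op_mx_id (bij_inj be')).
  by congr op_mx; apply/funext=> f; apply/funext.
- rewrite -op_mx_comp // -(op_mx_id (bij_inj be)).
  by congr op_mx; apply/funext=> f; apply/funext.
- rewrite -!op_mx_comp //.
  by congr op_mx; apply/funext=> f; apply/funext.
Qed.

Lemma op_char_polyE T n (e : 'I_n -> T) F :
  bijective e -> linear_op F -> op_char_poly F = char_poly (op_mx e e F).
Proof.
move=> be linF; apply: (@op_mx_sim _ _ _ _ _ _ _ _ id id) => //.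
exact: enum_val_bij.
Qed.

Lemma op_char_poly_sim T S (F : (T -> K) -> (T -> K)) (G : (S -> K) -> (S -> K))
    (P : (T -> K) -> (S -> K)) (Q : (S -> K) -> (T -> K)) :
  linear_op F -> linear_op G -> linear_op P -> linear_op Q ->
  (forall f u, P (Q f) u = f u) -> (forall f u, Q (P f) u = f u) ->
  (forall f u, P (F f) u = G (P f) u) ->
  op_char_poly F = op_char_poly G.
Proof. by apply: op_mx_sim; exact: enum_val_bij. Qed.

Definition extend_inl T S (f : T -> K) (z : T + S) : K :=
  if z is inl x then f x else 0.

(** The condition on [inr] makes the lower left block zero when [T] is listed before [S]; the upper
    right block is arbitrary. *)
Lemma op_char_poly_sum T S (F : (T + S -> K) -> (T + S -> K)) F1 F2 :
  linear_op F -> linear_op F1 -> linear_op F2 ->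
  (forall f x, F (extend_inl f) (inl x) = F1 f x) ->
  (forall f y, F f (inr y) = F2 (fun y' => f (inr y')) y) ->
  op_char_poly F = op_char_poly F1 * op_char_poly F2.
Proof.
move=> linF linF1 linF2 FF1 FF2.
pose e (i : 'I_(#|T| + #|S|)) : T + S :=
  match split i with inl a => inl (enum_val a) | inr b => inr (enum_val b) end.
have be : bijective e.
  exists (fun z => unsplit (match z with inl x => inl (enum_rank x)
                                       | inr y => inr (enum_rank y) end)).
    by move=> i; rewrite /e; case: splitP => j ij; apply/val_inj;
      rewrite /= ?enum_valK.
  by case=> z; rewrite /e unsplitK enum_rankK.
rewrite (op_char_polyE be linF).
have -> : op_mx e e F =
    block_mx (op_mx enum_val enum_val F1) (ursubmx (op_mx e e F))
             0 (op_mx enum_val enum_val F2).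
  rewrite -[LHS]submxK; congr block_mx.
  - apply/matrixP=> i j; rewrite !mxE /e !(unsplitK (inl _)) -FF1.
    by congr (F _ _); apply/funext; case.
  - apply/matrixP=> i j; rewrite !mxE /e (unsplitK (inl _)) (unsplitK (inr _)).
    by rewrite FF2; apply: linear_op0.
  - apply/matrixP=> i j; rewrite !mxE /e !(unsplitK (inr _)) FF2.
    by congr (F2 _ _).
rewrite /char_poly /char_poly_mx map_block_mx (scalar_mx_block #|T| #|S|).
by rewrite opp_block_mx add_block_mx map_mx0 oppr0 addr0 det_ublock.
Qed.

(** [G] acts as [F] on each slice, so one slice splits off as a direct summand; induction on the
    number of slices. *)
Lemma op_char_poly_prod T (I : finType) F (G : (T * I -> K) -> (T * I -> K)) :
  linear_op F ->
  (forall f t k, G f (t, k) = F (fun x => f (x, k)) t) ->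
  op_char_poly G = op_char_poly F ^+ #|I|.
Proof.
move=> linF.
move eqn: #|I| => n; elim: n => [|n IHn] in I eqn G * => GF.
  rewrite expr0 /op_char_poly.
  have: #|{: T * I}| = 0%N by rewrite card_prod eqn muln0.
  by move: (op_mx _ _ _); move: #|_| => m M m0; subst m; exact: det_mx00.
have linG : linear_op G by move=> a f g [t k]; rewrite !GF linF.
have /card_gt0P[k0 _] : (0 < #|I|)%N by rewrite eqn.
pose I' : finType := {k | k != k0}.
pose G' f (z : T + T * I') := match z with
  | inl t => F (fun x => f (inl x)) t
  | inr (t, k) => F (fun x => f (inr (x, k))) t end.
have linG' : linear_op G' by move=> a f g [t|[t k]] /=; rewrite linF.
pose P (f : T * I -> K) (z : T + T * I') :=
  match z with inl t => f (t, k0) | inr (t, k) => f (t, val k) end.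
(* [insub] fails exactly on the index [k0], whose slice is the [inl] summand. *)
pose Q (f : T + T * I' -> K) (z : T * I) :=
  if insub z.2 is Some k then f (inr (z.1, k)) else f (inl z.1).
have -> : op_char_poly G = op_char_poly G'.
  apply: (@op_char_poly_sim _ _ _ _ P Q) => //.
  - by move=> a f g [t|[t k]].
  - by move=> a f g [t k]; rewrite /Q /=; case: insubP.
  - move=> f [t|[t k]]; rewrite /P /Q /=; last by rewrite valK.
    by rewrite insubF ?eqxx.
  - move=> f [t k]; rewrite /P /Q /=; case: insubP => [k' _ -> //|].
    by rewrite negbK => /eqP->.
  - by move=> f [t|[t k]]; rewrite /= GF.
have cI' : #|I'| = n.
  by rewrite card_sig -[n]/(n.+1.-1) -eqn -(cardC1 k0); apply: eq_card.
rewrite (@op_char_poly_sum _ _ _ F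
   (fun f z => F (fun x => f (x, z.2)) z.1)) //.
- by rewrite exprS; congr (_ * _); apply: IHn.
- by move=> f [t k].
Qed.

End LinearOperators.

(** * Extension by zero and Dirichlet operators *)

Section ExtensionByZero.
Variables (K : comNzRingType) (T : finType) (P : pred T).

Definition extend0 (f : {x | P x} -> K) (x : T) : K :=
  if insub x is Some y then f y else 0.

Lemma extend0_in f x (Px : P x) : extend0 f x = f (exist _ x Px).
Proof. by rewrite /extend0 insubT. Qed.

Lemma extend0_val f y : extend0 f (val y) = f y.
Proof. by rewrite /extend0 valK. Qed.

Lemma extend0_out f x : ~~ P x -> extend0 f x = 0.
Proof. by move=> Px; rewrite /extend0 insubN. Qed.

Lemma extend0_eq0 f x : (forall y, f y = 0) -> extend0 f x = 0.
Proof. by rewrite /extend0; case: insubP. Qed.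

Lemma extend0_linear : linear_op extend0.
Proof.
by move=> a f g x; rewrite /extend0; case: insubP => // _; rewrite mulr0 addr0.
Qed.

End ExtensionByZero.

(** The complement of [W] is a subtype here, so that it can be a factor of a coordinate type. *)
Definition dirichlet (K : comNzRingType) (V : finType) (L : (V -> K) -> (V -> K))
    (W : {set V}) (f : {v | v \in ~: W} -> K) (v : {v | v \in ~: W}) : K :=
  L (extend0 f) (val v).

Lemma dirichlet_linear (K : comNzRingType) (V : finType)
    (L : (V -> K) -> (V -> K)) (W : {set V}) :
  linear_op L -> linear_op (@dirichlet K V L W).
Proof.
move=> linL a f g v; rewrite -linL; congr (L _ _).
by apply/funext=> x; rewrite extend0_linear.
Qed.

(** * Characteristic polynomial of an operator on glued copies *)

(* [J] indexes the copies of [V], grouped into frames by [t] with base copies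
   [c]; [q (v, k)] is the image of the vertex [v] of the copy [k], and [mu v k]
   is a probability distribution on the copies glued to [k] at [v]. *)
Section Gluing.
Variables (K : comNzRingType) (V I J U : finType).
Variables (L : (V -> K) -> (V -> K)) (V0 V1 : {set V}).
Variables (t : J -> I) (c : I -> J) (i0 : I) (q : V * J -> U) (qinv : U -> V * J).

Definition glued (v : V) (k k' : J) : bool :=
  [|| v \in V1, (v \in V0) && (t k == t k') | k == k'].

Variables (mu : V -> J -> J -> K) (F : (U -> K) -> (U -> K)).
Hypothesis linL : linear_op L.
Hypothesis V10 : V1 \subset V0.
Hypothesis cK : cancel c t.
Hypothesis qinvK : cancel qinv q.
Hypothesis qE : forall v v' k k',
  (q (v, k) == q (v', k')) = (v == v') && glued v k k'.
Hypothesis mu_sum : forall v k, \sum_k' mu v k k' = 1.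
Hypothesis mu_glued : forall v k k', ~~ glued v k k' -> mu v k k' = 0.
Hypothesis FE : forall f v k,
  F f (q (v, k)) = \sum_k' mu v k k' * L (fun x => f (q (x, k'))) v.

Local Notation rest1 := ({v | v \in ~: V1} * {i | i != i0})%type.
Local Notation rest0 := ({v | v \in ~: V0} * {k | k != c (t k)})%type.
Local Notation coords := (V + rest1 + rest0)%type.

(* [hpart f ^~ i] and [gpart f ^~ k] are the two kinds of differences, extended
   by 0 to all of [V] and to all indices. *)
Let hpart (f : coords -> K) v i : K :=
  extend0 (fun v' : {v | v \in ~: V1} =>
    extend0 (fun i' : {i | i != i0} => f (inl (inr (v', i')))) i) v.

Let gpart (f : coords -> K) v k : K :=
  extend0 (fun v' : {v | v \in ~: V0} =>
    extend0 (fun k' : {k | k != c (t k)} => f (inr (v', k'))) k) v.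

(** Inverse of the change of coordinates. The preimage picked by [qinv] is arbitrary; [of_coordsE]
    shows that any other gives the same value. *)
Let of_coords (f : coords -> K) u : K :=
  let: (v, k) := qinv u in f (inl (inl v)) + hpart f v (t k) + gpart f v k.

Let to_coords (f : U -> K) (z : coords) : K := match z with
  | inl (inl v) => f (q (v, c i0))
  | inl (inr (v, i)) => f (q (val v, c (val i))) - f (q (val v, c i0))
  | inr (v, k) => f (q (val v, val k)) - f (q (val v, c (t (val k))))
  end.

Let hpart_base f v : hpart f v i0 = 0.
Proof.
by apply: extend0_eq0 => v'; rewrite extend0_out ?negbK.
Qed.

Let gpart_base f v i : gpart f v (c i) = 0.
Proof.
by apply: extend0_eq0 => v'; rewrite extend0_out ?negbK ?cK.
Qed.

Let hpart_V1 f v i : v \in V1 -> hpart f v i = 0.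
Proof. by move=> vV; rewrite /hpart extend0_out // inE negbK. Qed.

Let gpart_V0 f v k : v \in V0 -> gpart f v k = 0.
Proof. by move=> vV; rewrite /gpart extend0_out // inE negbK. Qed.

Let hpart_linear v i : linear_op (fun f (_ : unit) => hpart f v i).
Proof.
move=> a f g _; rewrite /hpart -extend0_linear; congr (extend0 _ _).
by apply/funext=> x; rewrite extend0_linear.
Qed.

Let gpart_linear v k : linear_op (fun f (_ : unit) => gpart f v k).
Proof.
move=> a f g _; rewrite /gpart -extend0_linear; congr (extend0 _ _).
by apply/funext=> x; rewrite extend0_linear.
Qed.

Let gluedP v k k' : v \notin V0 -> glued v k k' -> k' = k.
Proof.
move=> vV0; have vV1 : v \notin V1 by apply: contra vV0; apply: (subsetP V10).
by rewrite /glued (negbTE vV0) (negbTE vV1) => /eqP.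
Qed.

Let glued_tag v k k' : v \notin V1 -> glued v k k' -> t k' = t k.
Proof.
by move=> vV1; rewrite /glued (negbTE vV1) /= => /orP[/andP[_ /eqP]|/eqP->].
Qed.

(** The weights sum to 1 and are supported on the glued copies, where [X] is constant. *)
Let mu_mean v k (X : J -> K) (y : K) :
  (forall k', glued v k k' -> X k' = y) -> \sum_k' mu v k k' * X k' = y.
Proof.
move=> Xy; rewrite -[y]mul1r -(mu_sum v k) mulr_suml; apply: eq_bigr => k' _.
by case: (boolP (glued v k k')) => [/Xy->//|/mu_glued->]; rewrite !mul0r.
Qed.

(** The copy chosen by [qinv] may differ from [k]: on [V1] both differences vanish, on the rest of
    [V0] the frame is the same and [gpart] vanishes, and outside [V0] the copy is [k] itself. *)
Let of_coordsE f v k :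
  of_coords f (q (v, k)) = f (inl (inl v)) + hpart f v (t k) + gpart f v k.
Proof.
rewrite /of_coords; case eqw: (qinv _) => [w k'].
have : q (w, k') == q (v, k) by rewrite -eqw qinvK.
rewrite qE => /andP[/eqP-> ] {w eqw} glu.
case: (boolP (v \in V1)) => [vV1|vV1].
  by rewrite !hpart_V1 // !gpart_V0 // (subsetP V10).
rewrite (glued_tag vV1 glu).
case: (boolP (v \in V0)) => [vV0|vV0]; first by rewrite !gpart_V0.
by rewrite (gluedP vV0 glu).
Qed.

Let to_coordsK f u : of_coords (to_coords f) u = f u.
Proof.
rewrite -(qinvK u); case: (qinv u) => v k {u}; rewrite of_coordsE.
(* The first two terms telescope to the value on the base copy of the frame of [k]; on [V1] this
   holds because all copies are glued there. *)
have -> : to_coords f (inl (inl v)) + hpart (to_coords f) v (t k)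
    = f (q (v, c (t k))).
  case: (boolP (v \in V1)) => [vV1|vV1].
    rewrite hpart_V1 // addr0 /=; congr f; apply/eqP.
    by rewrite qE eqxx /glued vV1.
  have vV1' : v \in ~: V1 by rewrite inE.
  have [->|ti0] := eqVneq (t k) i0; first by rewrite hpart_base addr0.
  by rewrite /hpart (extend0_in _ vV1')
    (@extend0_in K I (fun i => i != i0) _ _ ti0) /= addrC subrK.
case: (boolP (v \in V0)) => [vV0|vV0].
  rewrite gpart_V0 // addr0 /=; congr f; apply/eqP.
  by rewrite qE eqxx /glued vV0 cK eqxx orbT.
have vV0' : v \in ~: V0 by rewrite inE.
have [ek|nk] := eqVneq k (c (t k)).
  by rewrite {2}ek gpart_base addr0 -ek.
by rewrite /gpart (extend0_in _ vV0')
  (@extend0_in K J (fun k => k != c (t k)) _ _ nk) /= addrC subrK.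
Qed.

Let of_coordsK f z : to_coords (of_coords f) z = f z.
Proof.
case: z => [[v|[v i]]|[v k]] /=; rewrite !of_coordsE ?cK gpart_base ?hpart_base.
- by rewrite !addr0.
- rewrite gpart_base /hpart !extend0_val; ring.
- rewrite /gpart !extend0_val; ring.
Qed.

Let of_coords_linear : linear_op of_coords.
Proof.
move=> a f g u; rewrite -(qinvK u); case: (qinv u) => v k {u}.
rewrite !of_coordsE (hpart_linear v (t k) a f g tt).
rewrite (gpart_linear v k a f g tt); ring.
Qed.

Let to_coords_linear : linear_op to_coords.
Proof. by move=> a f g [[v|[v i]]|[v k]] /=; ring. Qed.

Let F_linear : linear_op F.
Proof.
move=> a f g u; rewrite -(qinvK u); case: (qinv u) => v k {u}.
rewrite !FE mulr_sumr -big_split /=; apply: eq_bigr => k' _.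
rewrite linL; ring.
Qed.

(** Outside [V1] gluing stays inside a frame, so all averaged copies share [hpart]; if they share
    [gpart] as well, the mean is over a constant. *)
Let F_of_coords f v k i : v \notin V1 -> t k = i ->
  (forall k', glued v k k' -> gpart f ^~ k' = gpart f ^~ k) ->
  F (of_coords f) (q (v, k)) =
    L (fun x => f (inl (inl x))) v + L (hpart f ^~ i) v + L (gpart f ^~ k) v.
Proof.
move=> vV1 tk gE; rewrite FE; apply: mu_mean => k' glu.
have -> : (fun x => of_coords f (q (x, k'))) =
    fun x => 1 * f (inl (inl x)) + (1 * hpart f x i + gpart f x k).
  apply/funext=> x; rewrite of_coordsE (glued_tag vV1 glu) tk.
  by rewrite (congr1 (@^~ x) (gE _ glu)) !mul1r addrA.
by rewrite !linL !mul1r addrA.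
Qed.

Lemma op_char_poly_gluing :
  op_char_poly F = op_char_poly L *
    op_char_poly (@dirichlet K V L V1) ^+ #|I|.-1 *
    op_char_poly (@dirichlet K V L V0) ^+ (#|J| - #|I|).
Proof.
pose T f := to_coords (F (of_coords f)).
have linT : linear_op T.
  by apply: linear_op_comp => //; apply: linear_op_comp.
have -> : op_char_poly F = op_char_poly T.
  apply: (@op_char_poly_sim _ _ _ _ _ to_coords of_coords) => // f u.
  by rewrite /T; congr (to_coords (F _) _); apply/funext=> x; rewrite to_coordsK.
(* The upper left block of [T]: the [gpart] coordinates are set to 0 in the input and dropped from
   the output. *)
pose T0 f x := T (extend_inl f) (inl x).
have gpart0 (f : V + rest1 -> K) k : gpart (extend_inl f) ^~ k = fun=> 0.
  by apply/funext=> v; apply: extend0_eq0 => v'; exact: extend0_eq0.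
have linT0 : linear_op T0.
  move=> a f g x; rewrite /T0 -linT; congr (T _ _).
  by apply/funext; case=> //= y; rewrite mulr0 addr0.
have linL0 u : L (fun=> 0) u = 0 by apply: linear_op0.
have linD W := @dirichlet_linear K V L W linL.
rewrite (@op_char_poly_sum _ _ _ T T0
  (fun f z => dirichlet L (fun x => f (x, z.2)) z.1)) //; last first.
(* Outside [V0] each copy is glued only to itself, so the values of [F] on [k] and on its base copy
   differ by [L] of [gpart] alone. *)
- move=> f [v k]; rewrite {1}/T /=.
  have vV0 : val v \notin V0 by have := valP v; rewrite inE.
  have vV1 : val v \notin V1 by apply: contra vV0; apply: (subsetP V10).
  rewrite !(@F_of_coords f _ _ (t (val k))) ?cK //;
    try by move=> k' /(gluedP vV0) ->.
  rewrite [X in _ - (_ + X)](_ : _ = 0); last first.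
    rewrite -(linL0 (val v)); congr (L _ _); apply/funext=> x.
    exact: gpart_base.
  rewrite addr0 addrC addKr; congr (L _ _); apply/funext=> x.
  rewrite /gpart; congr (extend0 _ _); apply/funext=> v'.
  by rewrite extend0_val.
- by move=> a f g [x k]; rewrite linD.
rewrite (@op_char_poly_sum _ _ _ T0 L
  (fun f z => dirichlet L (fun x => f (x, z.2)) z.1)) //; last first.
(* With [gpart] zero, [F_of_coords] applies at every vertex outside [V1]; comparing the base copies
   of [i] and [i0] leaves [L] of [hpart]. *)
- move=> f [v i]; rewrite {1}/T0 {1}/T /=.
  have vV1 : val v \notin V1 by have := valP v; rewrite inE.
  rewrite (@F_of_coords _ _ _ (val i)) ?cK //; last by move=> k' _; rewrite !gpart0.
  rewrite (@F_of_coords _ _ _ i0) ?cK //; last by move=> k' _; rewrite !gpart0.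
  rewrite !gpart0 !linL0 !addr0.
  rewrite [X in _ - (_ + X)](_ : _ = 0); last first.
    rewrite -(linL0 (val v)); congr (L _ _); apply/funext=> x.
    exact: hpart_base.
  rewrite addr0 addrC addKr; congr (L _ _); apply/funext=> x.
  rewrite /hpart; congr (extend0 _ _); apply/funext=> v'.
  by rewrite extend0_val.
(* With both differences zero every copy carries the same [f], so the mean is [L f], even on
   [V1]. *)
- move=> f v; rewrite {1}/T0 {1}/T /= FE; apply: mu_mean => k' _.
  congr (L _ _); apply/funext=> x; rewrite of_coordsE.
  rewrite (congr1 (@^~ x) (gpart0 _ _)) addr0 /= [hpart _ _ _]extend0_eq0 ?addr0 //.
  by move=> v'; exact: extend0_eq0.
- by move=> a f g [x k]; rewrite linD.
rewrite !(op_char_poly_prod (linD _)) //; congr (_ * _ ^+ _ * _ ^+ _).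
  by rewrite card_sig -(cardC1 i0); apply: eq_card.
rewrite card_sig -(cardC [pred k | k == c (t k)]).
(* The excluded indices are the base copies, one for each frame since [c] is injective. *)
have -> : #|[pred k | k == c (t k)]| = #|I|.
  rewrite -(card_codom (can_inj cK)); apply: eq_card => k; rewrite !inE.
  apply/eqP/codomP => [->|[i ->]]; last by rewrite cK.
  by exists (t k).
by rewrite addKn; apply: eq_card.
Qed.

End Gluing.

(** * Magnetic Laplacians as linear operators, and equality of contraction classes *)

Section MagneticGraphSpectra.
Variable R : realType.
Local Notation C := (complex R).
Implicit Type G : mgraph R.

Lemma lapop_linear G : linear_op (@lapop R G).
Proof.
move=> a f g u; rewrite /lapop.
under eq_bigr do rewrite mulrDr mulrCA.
rewrite big_split /= -mulr_sumr; ring.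
Qed.

Lemma char_poly_dirmx G (W : {set vert G}) :
  char_poly (dirmx W) = op_char_poly (@dirichlet C (vert G) (@lapop R G) W).
Proof.
pose e (i : 'I_#|~: W|) : {v | v \in ~: W} := exist _ (enum_val i) (enum_valP i).
have be : bijective e.
  apply: inj_card_bij => [i j /(congr1 val) /= /enum_val_inj//|].
  by rewrite card_ord card_sig; apply: eq_leq; apply: eq_card.
rewrite (op_char_polyE be); last exact/dirichlet_linear/lapop_linear.
congr char_poly; apply/matrixP=> i j; rewrite !mxE /dirichlet /=.
congr (lapop _ _); apply/funext=> x; rewrite /extend0; case: insubP => [y _ yx|].
  by rewrite /delta -yx -val_eqE.
by case: eqP => // -> /negP[]; exact: enum_valP.
Qed.

Lemma ccls_eq G (r : rel (vert G)) x y :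
  equivalence_rel r -> (ccls r x == ccls r y) = r x y.
Proof.
move=> eqr; rewrite -val_eqE /=; apply/eqP/idP => [|rxy].
  by move=> /setP/(_ y); rewrite !inE; case: (eqr y y y) => -> _ ->.
by apply/setP=> z; rewrite !inE; case: (eqr x y z) => _ /(_ rxy).
Qed.

Lemma ccls_surj G (r : rel (vert G)) (X : vert (contract r)) :
  exists x, ccls r x = X.
Proof. by case: X => X rX; have /imsetP[x _ eX] := rX; exists x; apply/val_inj. Qed.

Lemma fcls_eq G (V0 : {set vert G}) a v v' (j j' : 'I_a) :
  (fcls V0 (v, j) == fcls V0 (v', j')) = (v == v') && ((v \in V0) || (j == j')).
Proof.
rewrite ccls_eq => [|[x i] [y j1] [z k]]; rewrite /frame_rel /= !xpair_eqE.
  by rewrite -andb_orr orbC andbC; case: eqP => //=; rewrite andbC.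
rewrite !eqxx; split=> // /orP[/andP[/eqP-> /eqP->]//|/andP[/eqP-> yV0]].
by rewrite yV0 !andbT; case: eqP => //= _; rewrite !orbT.
Qed.

(** * The contracted union as a gluing of copies of the graph *)

Section FrameUnion.
Variables (G : mgraph R) (V0 V1 : {set vert G}) (A : seq nat).
Hypothesis V10 : V1 \subset V0.
Hypothesis A_gt0 : all (fun a => 0 < a)%N A.

Local Notation copy := {i : 'I_(size A) & 'I_(nth 0%N A i)}.
Local Notation tagc := (@tag 'I_(size A) (fun i => 'I_(nth 0%N A i))).
Local Notation copies_glued := (glued V0 V1 tagc).
Local Notation FU := (frame_union V0 A).

Definition frame_copy (k : copy) : vert G -> vert FU := fun v =>
  Tagged (fun i : 'I_(size A) => vert (frame V0 (nth 0%N A i)))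
         (fcls V0 (v, tagged k)).

(** The gluing map [q] of the abstract setting; a copy is a pair of a frame and an index in it, with
    the frame as its tag. *)
Definition contr_copy (x : vert G * copy) : vert (frame_union_contr V0 V1 A) :=
  ccls (@union_rel R G V0 V1 A) (frame_copy x.2 x.1).

Lemma frame_copy_eq v v' k k' :
  (frame_copy k v == frame_copy k' v') =
  (v == v') && ((v \in V0) && (tag k == tag k') || (k == k')).
Proof.
case: k k' => [i j] [i' j']; rewrite /frame_copy /=.
have [ii'|ii'] := eqVneq i i'.
  by case: _ / ii' in j' *; rewrite !eq_Tagged /= fcls_eq andbT.
by rewrite -!tag_eqE /tag_eq /= (negbTE ii') andbF /= andbF.
Qed.

Lemma frame_copy_surj x : exists z, frame_copy z.2 z.1 = x.
Proof.
case: x => i X; have [[v j] <-] := ccls_surj X.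
by exists (v, Tagged (fun i : 'I_(size A) => 'I_(nth 0%N A i)) j).
Qed.

(** A frame vertex containing some [(v1, j)] is a copy of [v1], so the existential clause means
    [v = v'] in [V1]; [frame_copy_eq] gives the other cases. *)
Lemma union_rel_copy v v' k k' :
  union_rel V1 (frame_copy k v) (frame_copy k' v') =
  (v == v') && copies_glued v k k'.
Proof.
rewrite /union_rel frame_copy_eq /glued.
have memV1 (w w1 : vert G) (l : copy) : w1 \in V1 ->
    [exists j, tagged (frame_copy l w) == fcls V0 (w1, j)] = (w == w1).
  move=> w1V1; apply/existsP/eqP => [[j]|->].
    by rewrite fcls_eq => /andP[/eqP].
  by exists (tagged l).
have -> : [exists v1 in V1,
       [exists j, tagged (frame_copy k v) == fcls V0 (v1, j)] &&
       [exists j, tagged (frame_copy k' v') == fcls V0 (v1, j)]] =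
   (v == v') && (v \in V1).
  apply/existsP/andP => [[v1 /and3P[v1V1]]|[/eqP<- vV1]].
    by rewrite !memV1 // => /eqP-> /eqP->.
  by exists v; rewrite !memV1 // vV1 eqxx.
by rewrite -andb_orr [_ || (v \in V1)]orbC.
Qed.

Lemma union_rel_equivalence : equivalence_rel (@union_rel R G V0 V1 A).
Proof.
move=> x y z; have [[v k] <-] := frame_copy_surj x.
have [[v' k'] <-] := frame_copy_surj y; have [[w l] <-] := frame_copy_surj z.
rewrite !union_rel_copy /glued /=; split; first by rewrite !eqxx !orbT.
move=> /andP[/eqP<-]; case: (v == w) => //=.
case: (v \in V1) => //=; case: (v \in V0) => /= [|/eqP-> //].
have tagE (k1 k2 : copy) :
    (tag k1 == tag k2) || (k1 == k2) = (tag k1 == tag k2).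
  by case: (eqVneq k1 k2) => [->|_]; rewrite ?eqxx // orbF.
by rewrite !tagE => /eqP->.
Qed.

Lemma contr_copy_eq v v' k k' :
  (contr_copy (v, k) == contr_copy (v', k')) =
  (v == v') && copies_glued v k k'.
Proof. by rewrite ccls_eq ?union_rel_copy //; exact: union_rel_equivalence. Qed.

Lemma contr_copy_surj u : exists x, contr_copy x = u.
Proof.
have [x <-] := ccls_surj u; have [z <-] := frame_copy_surj x.
by exists z.
Qed.

(** Contraction keeps all edges, so those leaving the class of [(v, k)] are the edges leaving [v] in
    each copy glued to [k] there. *)
Lemma sum_contr_edge (M : nmodType) (h : edge G -> copy -> M) v k :
  \sum_(e | src (frame_union_contr V0 V1 A) e == contr_copy (v, k))
     h (tagged e).1 (Tagged (fun i : 'I_(size A) => 'I_(nth 0%N A i)) (tagged e).2)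
  = \sum_(k' | copies_glued v k k') \sum_(e | src G e == v) h e k'.
Proof.
pose m (x : copy * edge G) : edge (frame_union_contr V0 V1 A) :=
  Tagged (fun i : 'I_(size A) => edge (frame V0 (nth 0%N A i)))
         ((x.2, tagged x.1) : edge (frame V0 (nth 0%N A (tag x.1)))).
rewrite (reindex m) /=; last first.
  exists (fun e => (Tagged (fun i : 'I_(size A) => 'I_(nth 0%N A i)) (tagged e).2,
                    (tagged e).1)).
    by move=> [[i j] e].
  by move=> [i [e j]].
rewrite pair_big /=; apply: eq_big => [[k' e]|[[i j] e]] //=.
rewrite eq_sym -[LHS]/(contr_copy (v, k) == contr_copy (src G e, k')).
by rewrite contr_copy_eq eq_sym andbC; case: eqP => //= ->.
Qed.

(** Uniform weights, since every glued copy contributes the same degree. *)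
Definition mean_weight v (k k' : copy) : C :=
  (copies_glued v k k')%:R /
  #|[pred k' | copies_glued v k k']|%:R.

Lemma card_glued_neq0 v k :
  #|[pred k' | copies_glued v k k']|%:R != 0 :> C.
Proof.
rewrite pnatr_eq0 -lt0n; apply/card_gt0P; exists k.
by rewrite inE /glued !eqxx !orbT.
Qed.

Lemma sum_mean_weight v k : \sum_k' mean_weight v k k' = 1.
Proof.
by rewrite -mulr_suml -natr_sum -big_mkcond sum1_card mulfV ?card_glued_neq0.
Qed.

(** With [N] glued copies the degree is [N] times that in [G], and [f] has one value on the whole
    class, so both terms of the Laplacian are averages. *)
Lemma lapop_contr_copy f v k :
  lapop f (contr_copy (v, k)) =
  \sum_k' mean_weight v k k' * lapop (fun x => f (contr_copy (x, k'))) v.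
Proof.
set N := #|[pred k' | copies_glued v k k']|.
have N0 : N%:R != 0 :> C by exact: card_glued_neq0.
have degE : degw (contr_copy (v, k)) = N%:R * degw v.
  rewrite /degw (sum_contr_edge (fun e _ => wt G e)) sumr_const.
  by rewrite mulr_natl.
rewrite /lapop degE.
rewrite (sum_contr_edge (fun e k' =>
  (wt G e)%:C%C * expi (pot G e) * f (contr_copy (tgt G e, k')))).
transitivity (\sum_(k' | copies_glued v k k') N%:R^-1 *
  (f (contr_copy (v, k)) - ((degw v)^-1)%:C%C *
   \sum_(e | src G e == v)
     (wt G e)%:C%C * expi (pot G e) * f (contr_copy (tgt G e, k')))); last first.
  rewrite big_mkcond; apply: eq_bigr => k' _; rewrite /mean_weight.
  case: ifP => glu; rewrite ?mul0r // mul1r; congr (_ * (_ - _)).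
  by congr f; apply/eqP; rewrite contr_copy_eq eqxx.
rewrite -mulr_sumr sumrB sumr_const -/N -mulr_sumr mulrBr -[f _ *+ N]mulr_natl mulKf //.
congr (_ - _); rewrite mulrA invfM rmorphM /= fmorphV rmorph_nat.
by [].
Qed.

Lemma char_poly_frame_union_contr (i0 : 'I_(size A)) :
  char_poly (lapmx (frame_union_contr V0 V1 A)) =
  char_poly (lapmx G) * char_poly (dirmx V1) ^+ (size A).-1 *
  char_poly (dirmx V0) ^+ (sumn A - size A).
Proof.
have c_gt0 (i : 'I_(size A)) : (0 < nth 0%N A i)%N by apply: (all_nthP 0%N A_gt0).
(* The base of each frame is its copy 0, which exists because the parts are positive. *)
pose c i : copy := Tagged (fun i : 'I_(size A) => 'I_(nth 0%N A i)) (Ordinal (c_gt0 i)).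
have [qinv qinvK] := fin_all_exists contr_copy_surj.
have := @op_char_poly_gluing C _ _ _ _ (@lapop R G) V0 V1 tagc c i0
  contr_copy qinv mean_weight (@lapop R _) (@lapop_linear G) V10.
rewrite -!char_poly_dirmx card_tagged card_ord => gluingE.
rewrite -[LHS]/(op_char_poly (@lapop R (frame_union_contr V0 V1 A))) gluingE //.
- congr (_ * _ ^+ (sumn _ - _)).
  (* The number of copies is the sum of the parts. *)
  rewrite (eq_map (fun i => card_ord _)) -[RHS](mkseq_nth 0%N) /mkseq.
  by rewrite -val_enum_ord -map_comp.
- by move=> v v' k k'; rewrite contr_copy_eq.
- exact: sum_mean_weight.
- by move=> v k k' /negbTE nglu; rewrite /mean_weight nglu mul0r.
- exact: lapop_contr_copy.
Qed.

End FrameUnion.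

(** * From characteristic polynomials to spectra as multisets *)

Lemma specE n (M : 'M[C]_n) : char_poly M = \prod_(z <- spec M) ('X - z%:P).
Proof. exact/eqP/(xchooseP (spec_ex M)). Qed.

Lemma prod_mscale k (s : seq C) :
  \prod_(z <- mscale k s) ('X - z%:P) = (\prod_(z <- s) ('X - z%:P)) ^+ k.
Proof.
elim: k => [|k IHk]; first by rewrite big_nil expr0.
by rewrite [mscale _ _]/(s ++ mscale k s) big_cat IHk exprS.
Qed.

End MagneticGraphSpectra.

Theorem theorem5p7 (R : realType) (G : mgraph R) (V0 V1 : {set vert G})
    (A : seq nat) (r : nat) :
  is_mgraph G ->
  V1 \subset V0 ->
  (0 < size A)%N -> all (fun a => 0 < a)%N A -> sumn A = r ->
  perm_eq (spec (lapmx (frame_union_contr V0 V1 A)))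
    (spec (lapmx G) ++ mscale (r - size A) (spec (dirmx V0))
                    ++ mscale (size A).-1 (spec (dirmx V1))).
Proof.
(* A product of monic linear factors determines the multiset of its roots, so it suffices to compare
   characteristic polynomials. *)
move=> _ V10 sA A_gt0 <-; apply: prod_XsubC_eq.
rewrite !big_cat /= !prod_mscale -!specE.
by rewrite (char_poly_frame_union_contr V10 A_gt0 (Ordinal sA)) -mulrA [X in _ * X]mulrC.
Qed.
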